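(* There exist absolute constants $\delta \in (0,1)$ and $c_0>0$ such that for arbitrarily large $n$ there is an instance of the Directed Steiner Tree problem on a directed graph with at most $n$ vertices (and with $n$ arbitrarily large along the family) whose integral optimum cost is at least $c_0\, n^{\delta}$ times the optimum value of the flow LP relaxation (FLP) of that instance. In other words, the integrality gap of (FLP) is $\Omega(n^{\delta})$, where $n$ is the number of vertices.
   Context: Directed Steiner Tree (DST): given a directed graph $G=(V,E)$ with $n=|V|$ vertices, edge costs $c\in\mathbb{R}_{\ge 0}^E$, a root $r\in V$ and a set $K\subseteq V$ of $k$ terminals, find a minimum-cost subgraph of $G$ containing a directed path from $r$ to every $t\in K$. For $t\in K$ let $\mathcal{P}_t$ be the set of simple directed $r\to t$ paths in $G$. The flow LP (FLP) is: minimize $\sum_{e\in E} c_e x_e$ subject to $\sum_{P\in\mathcal{P}_t} f^t_P = 1$ for all $t\in K$; $\sum_{P\in\mathcal{P}_t:\, e\in P} f^t_P \le x_e$ for all $e\in E,\ t\in K$; $x_e\ge 0$ for all $e\in E$; $f^t_P\ge 0$ for all $t\in K$, $P\in\mathcal{P}_t$. The integrality gap of an instance is the ratio of the minimum cost of a feasible DST solution to the optimum value of (FLP). *)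

(* Defs.v *)
From HB Require Import structures.
From mathcomp Require Import all_boot all_order all_algebra.
From mathcomp Require Import reals exp.
Set Implicit Arguments. Unset Strict Implicit. Unset Printing Implicit Defensive.
Import Order.TTheory GRing.Theory Num.Theory.
Local Open Scope ring_scope.

(* A DST instance: vertex set V (a finite type, n = #|V|), a simple directed
   graph given by its adjacency relation [adj] (edge (u,v) exists iff adj u v),
   edge costs [c u v], root [r], terminal set [K]. *)

Section DST.
Variables (R : realType) (V : finType) (adj : rel V) (c : V -> V -> R)
          (r : V) (K : {set V}).

Fixpoint seqs_upto (k : nat) : seq (seq V) :=
  match k with
  | 0 => [:: [::]]
  | k'.+1 => [::] :: [seq x :: s | x <- enum V, s <- seqs_upto k']
  end.

(* A path r -> t is represented by the sequence q of vertices after r,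
   i.e. the vertex sequence of the path is r :: q.  It is simple iff
   r :: q has no repeated vertex. *)
Definition is_simple_rt_path (t : V) (q : seq V) : bool :=
  [&& path adj r q, last r q == t & uniq (r :: q)].

Definition simple_paths (t : V) : seq (seq V) :=
  undup [seq q <- seqs_upto #|V| | is_simple_rt_path t q].

Definition edge_on_path (u v : V) (q : seq V) : bool :=
  (u, v) \in zip (r :: q) q.

Definition nonneg_costs : Prop := forall u v, adj u v -> 0 <= c u v.

Definition lp_value (x : V -> V -> R) : R :=
  \sum_(u : V) \sum_(v : V | adj u v) c u v * x u v.

Definition flp_feasible (x : V -> V -> R) (f : V -> seq V -> R) : Prop :=
  [/\ forall t, t \in K -> \sum_(q <- simple_paths t) f t q = 1,
      forall u v t, adj u v -> t \in K ->
        \sum_(q <- simple_paths t | edge_on_path u v q) f t q <= x u v,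
      forall u v, adj u v -> 0 <= x u v
    & forall t q, t \in K -> q \in simple_paths t -> 0 <= f t q].

Definition dst_feasible (F : {set V * V}) : Prop :=
  (forall e, e \in F -> adj e.1 e.2) /\
  (forall t, t \in K -> exists q : seq V,
       path (fun u v => (u, v) \in F) r q && (last r q == t)).

Definition dst_cost (F : {set V * V}) : R := \sum_(e in F) c e.1 e.2.

End DST.

(* Main.v *)
(** Words e : I * S -> Q are to be bought at cost |A| each, where |I| = 2h.  A
    type s : I -> S selects the graph of s inside I * S.  An entrance (s, v)
    leads to all words reading v along the graph of s; a terminal (s, e0) is
    reached from all words agreeing with e0 off the graph of s.

    Fractionally, a terminal (s, e0) spreads its flow evenly over its |Q|^2h
    words, entering each of them through the unique entrance of the same type s;
    these entrances are pairwise distinct, so capacity |Q|^-2h suffices.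

    Integrally, fix for each bought word one bought entrance leading to it, of
    type s' say.  If a terminal of type s uses this word, then either s and s'
    agree in at least h places, and few types s are that close to s', or s and s'
    disagree in more than h places, and then the terminal must satisfy more than h
    equations imposed by the bought entrance, which few terminals do.  With
    |S| = 2^4 and |Q| = 2^10 both ways of covering terminals lose a factor 4^h,
    while the graph has at most 4^(200 h) vertices. *)
Require Import Defs.
From HB Require Import structures.
From mathcomp Require Import all_boot all_order all_algebra.
From mathcomp Require Import reals exp.
From mathcomp Require Import zify.
Import Order.TTheory GRing.Theory Num.Theory.
Local Open Scope ring_scope.

Set Implicit Arguments. Unset Strict Implicit. Unset Printing Implicit Defensive.

(** * Counting the terminals that entrances and words can cover *)

Section Combinatorics.
Local Open Scope nat_scope.

Lemma card_ffun_family (X Y : finType) (F : X -> pred Y) :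
  #|[set f : {ffun X -> Y} | [forall x, F x (f x)]]| = \prod_x #|F x|.
Proof.
rewrite -sum1dep_card.
under [RHS]eq_bigr do rewrite -sum1_card.
rewrite (bigA_distr_big_dep F (fun _ _ => 1)).
apply: eq_big => [f|f _]; last by rewrite big1.
by apply/idP/familyP => [/forallP|] H; [|apply/forallP].
Qed.

Section Counting.
Variables (I S Q : finType).
Implicit Types (s : {ffun I -> S}) (e : {ffun I * S -> Q}).

Definition agree s s' : nat := #|[set p | s p == s' p]|.

Lemma near_count h s : (0 < #|S|)%N ->
  (#|[set s' | (h <= agree s s')%N]| * #|S| ^ h <= (2 * #|S|) ^ #|I|)%N.
Proof.
move=> S_gt0.
(* Markov's inequality for the weight |S| ^ agree s s'. *)
apply: (@leq_trans (\sum_s' #|S| ^ agree s s')).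
  rewrite -sum1dep_card big_distrl /= big_mkcond leq_sum // => s' _.
  by case: ifP => // le_h; rewrite mul1n leq_pexp2l.
have -> : \sum_s' #|S| ^ agree s s' =
          \sum_(s' : {ffun I -> S}) \prod_p (if s p == s' p then #|S| else 1).
  apply: eq_bigr => s' _; rewrite -big_mkcond /= prod_nat_const; congr (_ ^ _).
  by apply: eq_card => p; rewrite inE.
(* The sum over types factors over the positions: the agreeing letter contributes [#|S|] and every
   other letter 1, so each factor is at most [2 * #|S|]. *)
rewrite -(bigA_distr_bigA (fun p c => if s p == c then #|S| else 1)).
rewrite -prod_nat_const; apply: leq_prod => p _.
rewrite (bigD1 (s p)) //= eqxx mul2n -addnn leq_add2l.
rewrite (eq_bigr (fun=> 1)) => [|c /negPf]; last by rewrite eq_sym => ->.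
by rewrite sum1_card max_card.
Qed.


Lemma card_agree_off_graph s e :
  #|[set e' : {ffun I * S -> Q} |
      [forall x, (x.2 != s x.1) ==> (e' x == e x)]]| = #|Q| ^ #|I|.
Proof.
rewrite (card_ffun_family (fun x => [pred c | (x.2 != s x.1) ==> (c == e x)])).
transitivity (\prod_p \prod_c #|[pred y | (c != s p) ==> (y == e (p, c))]|).
  by rewrite pair_bigA; apply: eq_bigr => -[].
rewrite -prod_nat_const; apply: eq_bigr => p _.
rewrite (bigD1 (s p)) //= big1 ?muln1 => [|c ne].
  by apply: eq_card => y; rewrite !inE eqxx.
by rewrite -[RHS](card1 (e (p, c))); apply: eq_card => y; rewrite !inE ne.
Qed.

(** Each place where the types differ fixes the letter at its own coordinate [(p, s p)], so the
    equations are independent and each costs a factor [#|Q|]. *)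
Lemma card_agree_on_disagreement s s' (v : {ffun I -> Q}) :
  #|[set e : {ffun I * S -> Q} |
      [forall p, (s p != s' p) ==> (e (p, s p) == v p)]]|
    * #|Q| ^ (#|I| - agree s s') = #|{ffun I * S -> Q}|.
Proof.
pose F (x : I * S) : pred Q := fun c =>
  ((x.2 == s x.1) && (s x.1 != s' x.1)) ==> (c == v x.1).
have -> : [set e : {ffun I * S -> Q} |
      [forall p, (s p != s' p) ==> (e (p, s p) == v p)]]
    = [set e : {ffun I * S -> Q} | [forall x, F x (e x)]].
  apply/setP => e; rewrite !inE; apply/forallP/forallP => [H [p c] | H p] /=.
    by apply/implyP => /andP[/= /eqP-> ne]; apply: implyP (H p) ne.
  by have := H (p, s p); rewrite /F /= eqxx.
rewrite (card_ffun_family F) card_ffun card_prod.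
have -> : \prod_x #|F x| = \prod_p \prod_c #|F (p, c)|.
  by rewrite pair_bigA; apply: eq_bigr => -[].
rewrite [(#|I| * _)%N]mulnC expnM.
have -> : #|I| - agree s s' = #|[set p | s p != s' p]|.
  rewrite -(cardsC [set p | s p == s' p]) addKn.
  by apply: eq_card => p; rewrite !inE.
rewrite -2!prod_nat_const [X in _ * X]big_mkcond -big_split /=.
apply: eq_bigr => p _; rewrite inE -prod_nat_const.
rewrite (bigD1 (s p)) //= [RHS](bigD1 (s p)) //= mulnAC; congr (_ * _); last first.
  by apply: eq_bigr => c /negPf ne; apply: eq_card => y; rewrite !inE /F /= ne.
case: ifP => ne; rewrite ?muln1; last first.
  by apply: eq_card => y; rewrite !inE /F /= ne andbF.
rewrite -[RHS]mul1n -(card1 (v p)); congr (_ * _).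
by apply: eq_card => y; rewrite !inE /F /= eqxx ne.
Qed.

Definition carries (a : {ffun I -> S} * {ffun I -> Q}) e : bool :=
  [forall p, e (p, a.1 p) == a.2 p].

Definition serves e (t : {ffun I -> S} * {ffun I * S -> Q}) : bool :=
  [forall x, (x.2 != t.1 x.1) ==> (e x == t.2 x)].

(** The equations that an entrance imposes on a terminal, one for each place where their types
    differ. *)
Definition clashes (a : {ffun I -> S} * {ffun I -> Q})
    (t : {ffun I -> S} * {ffun I * S -> Q}) : bool :=
  [forall p, (a.1 p != t.1 p) ==> (t.2 (p, a.1 p) == a.2 p)].

Lemma carries_clashes a e t : carries a e -> serves e t -> clashes a t.
Proof.
move=> /forallP ae /forallP et; apply/forallP => p; apply/implyP => ne.
by rewrite -(eqP (ae p)) eq_sym; exact: implyP (et (p, a.1 p)) ne.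
Qed.

Definition far_block h a :=
  [set t | (agree a.1 t.1 < h)%N && clashes a t].

(* Testing proximity to one chosen entrance a of e suffices: by
   carries_clashes, a terminal served by e but not close to a clashes with a. *)
Definition near_block h (A' : {set {ffun I -> S} * {ffun I -> Q}}) e :=
  if [pick a in A' | carries a e] is Some a
  then [set t | (h <= agree a.1 t.1)%N && serves e t] else set0.

(** All types are allowed for; once the type is fixed, fewer than [h] agreements leave at least
    [#|I| - h] independent equations on the word of the terminal. *)
Lemma card_far_block h a : (0 < #|Q|)%N ->
  #|far_block h a| * #|Q| ^ (#|I| - h) <=
    #|{ffun I -> S}| * #|{ffun I * S -> Q}|.
Proof.
move=> Q_gt0; rewrite -sum1dep_card.
rewrite -(pair_big_dep (fun s => agree a.1 s < h)%N
   (fun s e => clashes a (s, e)) (fun _ _ => 1)) /=.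
rewrite big_distrl /= -[leqRHS]sum_nat_const big_mkcond leq_sum //= => s _.
case: ifP => // lt_h; rewrite sum1dep_card.
rewrite -(card_agree_on_disagreement a.1 s a.2) leq_mul ?leq_pexp2l //.
by rewrite leq_sub2l // ltnW.
Qed.

Lemma card_near_block h A' e : (0 < #|S|)%N ->
  #|near_block h A' e| * #|S| ^ h <= (2 * #|S|) ^ #|I| * #|Q| ^ #|I|.
Proof.
rewrite /near_block => S_gt0; case: pickP => [a _|_]; last by rewrite cards0.
rewrite -sum1dep_card -(pair_big_dep (fun s => h <= agree a.1 s)%N
   (fun s e' => serves e (s, e')) (fun _ _ => 1)) /=.
(* Agreement off the graph of [s] is symmetric in the two words, so each near type contributes
   [#|Q| ^ #|I|] terminals. *)
rewrite (eq_bigr (fun=> #|Q| ^ #|I|)) => [|s _]; last first.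
  rewrite sum1dep_card -(card_agree_off_graph s e); apply: eq_card => e'.
  by rewrite !inE; apply: eq_forallb => x; rewrite [e x == _]eq_sym.
rewrite sum_nat_const mulnAC leq_mul2r -cardsE near_count ?orbT //.
Qed.

Lemma cover_count h (A' : {set {ffun I -> S} * {ffun I -> Q}})
    (E' : {set {ffun I * S -> Q}}) :
    (forall t, exists a e, [/\ a \in A', e \in E', carries a e & serves e t]) ->
  #|{ffun I -> S}| * #|{ffun I * S -> Q}| <=
    \sum_(a in A') #|far_block h a| + \sum_(e in E') #|near_block h A' e|.
Proof.
move=> cov; rewrite -card_prod -sum1_card.
have -> : \sum_(a in A') #|far_block h a| =
    \sum_t \sum_(a in A') (t \in far_block h a).
  rewrite exchange_big; apply: eq_bigr => a _; rewrite -sum1_card big_mkcond.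
  by apply: eq_bigr => t _; case: (_ \in _).
have -> : \sum_(e in E') #|near_block h A' e| =
    \sum_t \sum_(e in E') (t \in near_block h A' e).
  rewrite exchange_big; apply: eq_bigr => a _; rewrite -sum1_card big_mkcond.
  by apply: eq_bigr => t _; case: (_ \in _).
rewrite -big_split /=; apply: leq_sum => t _.
have [a [e [aA eE ae et]]] := cov t.
(* The picked [a'] may differ from [a], which only shows that the pick succeeds. *)
have := erefl (near_block h A' e); rewrite {2}/near_block.
case: pickP => [a' /andP[a'A a'e] def_nb|/(_ a)]; last by rewrite aA ae.
have [near|far] := leqP h (agree a'.1 t.1).
  by rewrite addnC (bigD1 e) //= def_nb inE near et.
by rewrite (bigD1 a') //= inE far (carries_clashes a'e et).
Qed.

End Counting.

(** * Numerical bounds for the chosen alphabet sizes *)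

Section Gap.
Variables (h : nat) (I S Q : finType).
Hypotheses (cardI : #|I| = 2 * h) (cardS : #|S| = 2 ^ 4) (cardQ : #|Q| = 2 ^ 10).

Lemma card_types : #|{ffun I -> S}| = 2 ^ (8 * h).
Proof. by rewrite card_ffun cardI cardS -expnM mulnA. Qed.

Lemma card_labels : #|{ffun I -> Q}| = 2 ^ (20 * h).
Proof. by rewrite card_ffun cardI cardQ -expnM mulnA. Qed.

Lemma card_words : #|{ffun I * S -> Q}| = 2 ^ (320 * h).
Proof.
rewrite card_ffun card_prod cardI cardS cardQ -expnM; congr (_ ^ _).
by rewrite (_ : 2 ^ 4 = 16) //; lia.
Qed.

Lemma far_block_small (a : {ffun I -> S} * {ffun I -> Q}) :
  #|far_block h a| * 2 ^ (2 * h) <= #|{ffun I * S -> Q}|.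
Proof.
have Q_gt0 : 0 < #|Q| by rewrite cardQ expn_gt0.
have := card_far_block h a Q_gt0; rewrite card_types.
rewrite cardI (_ : 2 * h - h = h) ?cardQ -?expnM; last by lia.
(* Of the gain [#|Q| ^ h], a factor [2 ^ (8 * h)] pays for the number of types. *)
rewrite (_ : 10 * h = 2 * h + 8 * h); last by lia.
by rewrite expnD mulnA [leqRHS]mulnC leq_pmul2r ?expn_gt0.
Qed.

Lemma near_block_small A' e :
  #|@near_block I S Q h A' e| * 2 ^ (2 * h) <=
    #|{: {ffun I -> S} * {ffun I -> Q}}|.
Proof.
have S_gt0 : 0 < #|S| by rewrite cardS expn_gt0.
have := card_near_block h A' e S_gt0; rewrite -card_ffun.
rewrite card_prod card_types card_labels cardI cardS -expnS -!expnM -!expnD.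
(* The bound exceeds the number [2 ^ (28 * h)] of entrances by [2 ^ (2 * h)]; the gain [#|S| ^ h]
   pays for this and leaves as much again. *)
rewrite (_ : 5 * _ + _ = (8 * h + 20 * h) + 2 * h); last by lia.
rewrite (_ : 4 * h = 2 * h + 2 * h); last by lia.
by rewrite !(expnD _ _ (2 * h)) mulnA leq_pmul2r // expn_gt0.
Qed.

(** The right-hand side is the price of [A'] and [E'] in the layered graph below. *)
Lemma cover_cost (A' : {set {ffun I -> S} * {ffun I -> Q}})
    (E' : {set {ffun I * S -> Q}}) :
    (forall t, exists a e, [/\ a \in A', e \in E', carries a e & serves e t]) ->
  2 ^ (2 * h) * (#|{ffun I -> S}| * #|{ffun I * S -> Q}|) <=
    #|A'| * #|{ffun I * S -> Q}|
      + #|E'| * #|{: {ffun I -> S} * {ffun I -> Q}}|.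
Proof.
move=> /(cover_count h) le_cov; rewrite mulnC.
apply: leq_trans (leq_mul le_cov (leqnn _)) _.
rewrite mulnDl !big_distrl leq_add //= -sum_nat_const; apply: leq_sum => x _.
  exact: far_block_small.
exact: near_block_small.
Qed.

End Gap.
End Combinatorics.

(** * Simple paths and flows constant on a list of them *)

Section SimplePaths.
Variables (R : realType) (V : finType) (adj : rel V) (r : V).

Lemma mem_seqs_upto k (s : seq V) : (size s <= k)%N -> s \in seqs_upto V k.
Proof.
elim: k s => [|k IHk] [|x s] //= le_sk; rewrite inE //=.
by apply/allpairsP; exists (x, s); split; rewrite ?mem_enum ?IHk.
Qed.

Lemma mem_simple_paths t q :
  (q \in simple_paths adj r t) = is_simple_rt_path adj r t q.
Proof.
rewrite mem_undup mem_filter andb_idr // => /and3P[_ _ uq].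
by apply/mem_seqs_upto/ltnW; rewrite -[(size q).+1](card_uniqP uq) max_card.
Qed.

Lemma sum_indicator_simple_paths t (P : pred (seq V)) (s : seq (seq V)) (z : R) :
    uniq s -> {subset s <= is_simple_rt_path adj r t} ->
  \sum_(q <- simple_paths adj r t | P q) (if q \in s then z else 0)
    = z *+ count P s.
Proof.
move=> us ss; rewrite -big_mkcondr /= -big_filter.
have /(perm_big _)-> : perm_eq
    [seq q <- simple_paths adj r t | P q && (q \in s)] [seq q <- s | P q].
  apply: uniq_perm; rewrite ?filter_uniq ?undup_uniq // => q.
  rewrite !mem_filter mem_simple_paths -andbA; congr (_ && _).
  by apply: andb_idr => /ss.
by rewrite big_const_seq count_predT size_filter iter_addr_0.
Qed.

End SimplePaths.

(** * The layered graph, its costs and its integral solutions *)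

Section LayeredInstance.
Variables (R : realType) (A E T : finType).
Variables (inc : A -> E -> bool) (out : E -> T -> bool).

(* The edges nodeB e -> nodeC e carry the cost of the word e. *)
Notation vertex := (unit + A + (E + E) + T)%type.

Definition root : vertex := inl (inl (inl tt)).
Definition nodeA (a : A) : vertex := inl (inl (inr a)).
Definition nodeB (e : E) : vertex := inl (inr (inl e)).
Definition nodeC (e : E) : vertex := inl (inr (inr e)).
Definition nodeT (t : T) : vertex := inr t.

Definition layered (u v : vertex) : bool :=
  match u, v with
  | inl (inl (inl _)), inl (inl (inr _)) => true
  | inl (inl (inr a)), inl (inr (inl e)) => inc a e
  | inl (inr (inl e)), inl (inr (inr e')) => e == e'
  | inl (inr (inr e)), inr t => out e t
  | _, _ => false
  end.

(** The prices are balanced: buying all entrances costs as much as buying all words. *)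
Definition layered_cost (u v : vertex) : R :=
  match u, v with
  | inl (inl (inl _)), inl (inl (inr _)) => #|E|%:R
  | inl (inr (inl e)), inl (inr (inr e')) => if e == e' then #|A|%:R else 0
  | _, _ => 0
  end.

Definition terminals : {set vertex} := [set nodeT t | t : T].

Lemma layered_cost_ge0 u v : 0 <= layered_cost u v.
Proof. by case: u v => [[[]|[]]|] ? [[[]|[]]|] ? //=; case: ifP. Qed.

Lemma dst_cost_layered (F : {set vertex * vertex}) :
  dst_cost layered_cost F =
    (#|[set a | (root, nodeA a) \in F]| * #|E|
     + #|[set e | (nodeB e, nodeC e) \in F]| * #|A|)%:R.
Proof.
rewrite /dst_cost (eq_bigl (fun p => (p.1, p.2) \in F)); last by case.
rewrite -(pair_big_dep xpredT (fun u v => (u, v) \in F) layered_cost) /=.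
have z0 (I : finType) (P : pred I) : \sum_(i | P i) (0 : R) = 0 by rewrite big1.
rewrite big_sumType /= [X in _ + X]big1 => [|t _]; last first.
  by rewrite big1 // => -[[[]|[]]|].
rewrite big_sumType /= !big_sumType /=.
rewrite [X in _ + X + (_ + _)]big1 => [|a _]; last first.
  by rewrite big1 // => -[[[]|[]]|].
rewrite [X in _ + (_ + X)]big1 => [|e _]; last first.
  by rewrite big1 // => -[[[]|[]]|].
rewrite !addr0 (big_pred1 tt) => [|[]] //=; rewrite natrD !natrM; congr (_ + _).
  rewrite !big_sumType /= !z0 add0r !addr0 sumr_const mulr_natl.
  by congr (_ *+ _); apply: eq_card => a; rewrite inE.
rewrite mulr_natl -[RHS]sumr_const [RHS]big_mkcond; apply: eq_bigr => e _.
rewrite !big_sumType /= !z0 !add0r addr0 -big_mkcondr /=.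
rewrite big_mkcond (bigD1 e) //= eqxx andbT inE big1 ?addr0 // => e' /negPf ne.
by rewrite eq_sym ne andbF.
Qed.

Lemma lp_value_layered (z : R) :
  lp_value layered layered_cost (fun _ _ => z) = z * (2 * #|A| * #|E|)%:R.
Proof.
(* Under a uniform capacity the LP value is [z] times the cost of buying every edge. *)
transitivity (z * dst_cost layered_cost [set p | layered p.1 p.2]).
  rewrite /dst_cost /lp_value pair_big_dep mulr_sumr.
  by apply: eq_big => [p|p _]; rewrite ?inE // mulrC.
rewrite dst_cost_layered; congr (_ * _%:R).
have -> : [set a | (root, nodeA a) \in [set p | layered p.1 p.2]] = setT.
  by apply/setP => a; rewrite !inE.
have -> : [set e | (nodeB e, nodeC e) \in [set p | layered p.1 p.2]] = setT.
  by apply/setP => e; rewrite !inE /= eqxx.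
by rewrite !cardsT -mulnA mul2n -addnn [(#|E| * _)%N]mulnC.
Qed.

Lemma dst_feasible_layered (F : {set vertex * vertex}) t :
    dst_feasible layered root terminals F ->
  exists a e, [/\ (root, nodeA a) \in F, (nodeB e, nodeC e) \in F,
                  inc a e & out e t].
Proof.
case=> Fadj /(_ (nodeT t)) []; first exact: imset_f.
(* With adjacency recorded at every step, the layers leave one possible kind of vertex in each case
   split below, and the walk must stop at the terminal. *)
have walk q u : path (fun u v => (u, v) \in F) u q ->
    path (fun u v => layered u v && ((u, v) \in F)) u q.
  by elim: q u => //= v q IHq u /andP[Fuv /IHq ->]; rewrite Fuv (Fadj _ Fuv).
move=> q /andP[/walk {walk}].
case: q => [|[[[[]|a]|[e|e]]|t1] q] //= /andP[aF].
case: q => [|[[[[]|a']|[e|e]]|t1] q] //= /andP[/andP[ae _]].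
case: q => [|[[[[]|a']|[e'|e']]|t1] q] //= /andP[/andP[/eqP<- eF]].
case: q => [|[[[[]|a']|[e1|e1]]|t1] q] //= /andP[/andP[et1 _]].
case: q => [_ /eqP[<-] | v q /andP[/andP[]] //].
by exists a, e.
Qed.

(** * The uniform fractional flow *)

Section Flow.
Variables (route : T -> E -> A) (d : nat).
Hypothesis d_gt0 : (0 < d)%N.
Hypothesis inc_route : forall t e, inc (route t e) e.
Hypothesis route_inj :
  forall t e e', out e t -> out e' t -> route t e = route t e' -> e = e'.
Hypothesis card_out : forall t, #|[pred e | out e t]| = d.

Definition route_path t e : seq vertex :=
  [:: nodeA (route t e); nodeB e; nodeC e; nodeT t].

Definition route_paths t := [seq route_path t e | e in [pred e | out e t]].

Definition route_flow (u : vertex) (q : seq vertex) : R :=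
  if u is inr t then if q \in route_paths t then d%:R^-1 else 0 else 0.

Lemma uniq_route_paths t : uniq (route_paths t).
Proof. by rewrite map_inj_uniq ?enum_uniq // => e e' []. Qed.

(** Every edge of a route determines its word: the last three edges mention it, and the edge out of
    the root does so by [route_inj]. *)
Lemma count_route_paths_edge t u v :
  (count (edge_on_path root u v) (route_paths t) <= 1)%N.
Proof.
rewrite -size_filter.
case def_s: [seq _ <- _ | _] => [|p s] //.
have us : uniq (p :: s) by rewrite -def_s filter_uniq ?uniq_route_paths.
apply: (@uniq_leq_size _ _ [:: p]) => // q.
have : p \in p :: s by rewrite mem_head.
rewrite -def_s !mem_filter => /andP[pe /imageP[e oe def_p]].
case/andP=> [qe /imageP[e' oe' def_q]].
rewrite inE def_p def_q; apply/eqP; congr (route_path t _).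
move: oe oe'; rewrite !inE => oe oe'.
move: pe qe; rewrite def_p def_q /edge_on_path /= !inE.
by case/or4P=> /eqP[-> ->] /or4P[] /eqP[] // => /route_inj->.
Qed.

Lemma route_flow_feasible :
  flp_feasible layered root terminals (fun _ _ => d%:R^-1) route_flow.
Proof.
have simple t :
    {subset route_paths t <= is_simple_rt_path layered root (nodeT t)}.
  move=> _ /imageP[e oe ->]; rewrite unfold_in /is_simple_rt_path /= inc_route.
  by rewrite !eqxx andbT /=; move: oe; rewrite inE => ->.
split=> [_ /imsetP[t _ ->] | u v _ _ /imsetP[t _ ->] | * | u q _ _].
- rewrite sum_indicator_simple_paths ?uniq_route_paths //.
  rewrite count_predT size_image card_out.
  rewrite -[LHS]mulr_natr mulVf //.
  by rewrite pnatr_eq0 -lt0n.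
- rewrite sum_indicator_simple_paths ?uniq_route_paths //.
  have := count_route_paths_edge t u v.
  by case: count => [|[|]] //; rewrite invr_ge0.
- by rewrite invr_ge0.
- by rewrite /route_flow; case: u => // t; case: ifP => // _; rewrite invr_ge0.
Qed.

End Flow.
End LayeredInstance.

(** * The family of instances and the exponent of the gap *)

Lemma serves_inj_on_graph (I S Q : finType) (t : {ffun I -> S} * {ffun I * S -> Q})
    (e e' : {ffun I * S -> Q}) :
  serves e t -> serves e' t ->
  (forall p, e (p, t.1 p) = e' (p, t.1 p)) -> e = e'.
Proof.
move=> /forallP et /forallP e't ee'; apply/ffunP => -[p c].
have [-> // | ne] := eqVneq c (t.1 p).
by rewrite (eqP (implyP (et (p, c)) ne)) (eqP (implyP (e't (p, c)) ne)).
Qed.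

Lemma powR_root_le (R : realType) (n m k : nat) :
  (0 < k)%N -> (n <= m ^ k)%N -> n%:R `^ k%:R^-1 <= m%:R :> R.
Proof.
move=> k_gt0 le_nm.
have -> : m%:R = (m ^ k)%:R `^ k%:R^-1 :> R.
  rewrite natrX -powR_mulrn ?ler0n // -powRrM divff ?powRr1 ?ler0n //.
  by rewrite pnatr_eq0 -lt0n.
by rewrite ge0_ler_powR ?nnegrE ?invr_ge0 ?ler0n // ler_nat.
Qed.

Theorem theorem1 (R : realType) :
  exists delta c0 : R, [/\ 0 < delta, delta < 1, 0 < c0 &
    forall N : nat, exists (V : finType) (adj : rel V) (c : V -> V -> R)
                           (r : V) (K : {set V}),
      [/\ (N <= #|V|)%N, nonneg_costs adj c &
        exists (x : V -> V -> R) (f : V -> seq V -> R),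
          [/\ flp_feasible adj r K x f, 0 < lp_value adj c x &
            forall F : {set V * V}, dst_feasible adj r K F ->
              c0 * (#|V|%:R `^ delta) * lp_value adj c x <= dst_cost c F]]].
Proof.
(* The loss is [2 ^ (2 * h)] and the graph has at most [2 ^ (400 * h)] vertices, whence the
   exponent; the constant cancels the 2 in the LP value. *)
exists 200%:R^-1, 2^-1; split; rewrite ?invr_gt0 ?invf_lt1 ?ltr0n ?ltr1n //.
(* The successor keeps [h] positive, as [ge8] below requires. *)
move=> N; pose h := N.+1.
pose I : finType := 'I_(2 * h); pose S : finType := 'I_(2 ^ 4).
pose Q : finType := 'I_(2 ^ 10).
have cardI : #|I| = (2 * h)%N := card_ord _.
have cardS : #|S| = (2 ^ 4)%N := card_ord _.
have cardQ : #|Q| = (2 ^ 10)%N := card_ord _.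
(* Forget the carriers, so that nothing ever computes 2 ^ 10 in unary. *)
move: I S Q cardI cardS cardQ => I S Q cardI cardS cardQ.
pose A : finType := ({ffun I -> S} * {ffun I -> Q})%type.
pose E : finType := {ffun I * S -> Q}.
pose T : finType := ({ffun I -> S} * E)%type.
have cT := card_types cardI cardS; have cL := card_labels cardI cardQ.
have cW := card_words cardI cardS cardQ.
(* This is [#|Q| ^ #|I|], both the number of words serving a terminal and the number of entrances of
   a given type. *)
pose d := (2 ^ (20 * h))%N.
have d_gt0 : (0 < d)%N by rewrite expn_gt0.
pose route (t : T) (e : E) : A := (t.1, [ffun p => e (p, t.1 p)]).
exists (unit + A + (E + E) + T)%type, (layered (@carries I S Q) (@serves I S Q)),
  (@layered_cost R A E T), (root A E T), (terminals A E T).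
have cardV : #|{: unit + A + (E + E) + T}| =
    (1 + 2 ^ (28 * h) + (2 ^ (320 * h) + 2 ^ (320 * h)) + 2 ^ (328 * h))%N.
  rewrite !card_sum card_unit !card_prod cT cL cW -!expnD.
  by congr (_ + 2 ^ _ + _ + 2 ^ _)%N; lia.
split.
- rewrite cardV; apply: leq_trans (ltnW (ltn_expl N (isT : 1 < 2)%N)) _.
  apply: leq_trans (leq_addl _ _); rewrite leq_exp2l //.
  by rewrite /h; lia.
- by move=> u v _; exact: layered_cost_ge0.
exists (fun _ _ => d%:R^-1), (route_flow R (@serves I S Q) route d).
have lpE : lp_value (layered (@carries I S Q) (@serves I S Q))
    (@layered_cost R A E T) (fun _ _ => d%:R^-1) = 2 * (#|{ffun I -> S}| * #|E|)%:R.
  rewrite lp_value_layered card_prod cL -/d !natrM.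
  by rewrite [_ * d%:R]mulrC [2 * _]mulrCA -!mulrA mulKf ?pnatr_eq0 -?lt0n.
split.
- apply: route_flow_feasible => //.
  + by move=> t e; apply/forallP => p; rewrite ffunE.
  + move=> t e e' et e't [] /ffunP ee'; apply: serves_inj_on_graph et e't _ => p.
    by have := ee' p; rewrite !ffunE.
  + move=> t; rewrite /d -cL card_ffun -(card_agree_off_graph t.1 t.2) -cardsE.
    by apply: eq_card => e; rewrite !inE.
- by rewrite lpE mulr_gt0 // ltr0n cT /E cW muln_gt0 !expn_gt0.
move=> F Ffeas; rewrite lpE dst_cost_layered.
set A' := [set a | _]; set E' := [set e | _].
have cov t : exists a e, [/\ a \in A', e \in E', carries a e & serves e t].
  have [a [e [aF eF ae et]]] := dst_feasible_layered t Ffeas.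
  by exists a, e; rewrite !inE.
have := cover_cost cardI cardS cardQ cov; rewrite -(ler_nat R); apply: le_trans.
rewrite mulrACA mulVf ?pnatr_eq0 // mul1r [leRHS]natrM.
rewrite ler_wpM2r //; apply: powR_root_le => //.
(* Each of the five summands of [#|V|] is at most [2 ^ (328 * h)], and [2 ^ (72 * h)] absorbs the
   factor 5. *)
have le328 k : (k <= 328)%N -> (2 ^ (k * h) <= 2 ^ (328 * h))%N.
  by move=> le_k; rewrite leq_exp2l // leq_mul2r le_k orbT.
have ge8 : (8 <= 2 ^ (72 * h))%N.
  by rewrite -[8%N]/(2 ^ 3)%N leq_exp2l // /h; lia.
rewrite cardV -expnM (_ : 2 * h * 200 = 72 * h + 328 * h)%N; last by lia.
rewrite expnD; apply: leq_trans (leq_mul ge8 (leqnn _)).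
have := le328 28 isT; have := le328 320 isT; have := expn_gt0 2 (328 * h).
by move: (2 ^ _)%N (2 ^ _)%N (2 ^ _)%N => x y z; lia.
Qed.
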